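(* Let $\gamma$ be an $n$-Frenet curve parametrized by the arc length $s$ in an $m$-dimensional semi-Riemannian manifold $(M^m_t,g)$ of index $t$, $1\le t\le m-1$, $m\ge n\ge4$, with Frenet frame $\{F_1,\dots,F_n\}$ and curvatures $k_1,\dots,k_{n-1}$. Assume that $$\langle R(F_1,F_2)F_1,W\rangle=0\qquad\text{for all } W\in\big(\mathrm{Span}\{F_1,\dots,F_n\}\big)^\perp.$$ Then $\gamma$ is proper biharmonic if and only if $$\begin{cases}k_1=\kappa_1=\text{constant}>0\\ \epsilon_1k_1^2+\epsilon_3k_2^2=\langle R(F_2,F_1)F_1,F_2\rangle\\ k_2'=-\langle R(F_2,F_1)F_1,F_3\rangle\\ \epsilon_3k_2k_3=-\langle R(F_2,F_1)F_1,F_4\rangle\\ \langle R(F_2,F_1)F_1,F_i\rangle=0,\quad 5\le i\le n.\end{cases}$$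
   Context: Conventions. $\langle\,,\rangle=g$, $\nabla$ is the Levi-Civita connection and $R(X,Y)Z=\nabla_X\nabla_YZ-\nabla_Y\nabla_XZ-\nabla_{[X,Y]}Z$. Curves $\gamma:I\to M$ ($I$ an open real interval) are smooth, nonnull, parametrized by arc length; $T=\gamma'$. A curve is biharmonic if $\tau_2(\gamma)=\nabla_T\nabla_T\nabla_TT+R(\nabla_TT,T)T=0$, and proper biharmonic if it is biharmonic and not a geodesic. An $n$-Frenet curve (Frenet curve of order $n\le m$) is a curve admitting a frame field $\{F_1=T,F_2,\dots,F_n\}$ along it with $\langle F_j,F_j\rangle=\epsilon_j=\pm1$, $\langle F_i,F_j\rangle=0$ for $i\ne j$, and $$\nabla_TF_1=\epsilon_2k_1F_2,\quad \nabla_TF_i=-\epsilon_{i-1}k_{i-1}F_{i-1}+\epsilon_{i+1}k_iF_{i+1}\ (1<i<n),\quad \nabla_TF_n=-\epsilon_{n-1}k_{n-1}F_{n-1},$$ where the curvatures $k_1(s),\dots,k_{n-1}(s)$ are positive smooth functions (if $M$ is oriented and $n=m$, $k_{n-1}$ is allowed to take any real value, $F_n$ being fixed by requiring $\{F_1,\dots,F_n\}$ to be positively oriented). *)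

(* Defs.v *)
From HB Require Import structures.
Set Warnings "-all".
From mathcomp Require Export all_boot all_order all_algebra.
From mathcomp Require Export all_classical all_reals all_analysis.

Set Implicit Arguments.
Unset Strict Implicit.
Unset Printing Implicit Defensive.

Export Order.TTheory GRing.Theory Num.Theory.
Export numFieldNormedType.Exports.

#[export] Set Implicit Arguments.
#[export] Unset Strict Implicit.
#[export] Unset Printing Implicit Defensive.

Local Open Scope classical_set_scope.
Local Open Scope ring_scope.

(* C^oo on an open set D: every iterated directional derivative of f
   (including f itself, vs = [::]) is Frechet differentiable on D. *)
Definition iter_derive (R : realType) (V W : normedModType R)
    (vs : seq V) (f : V -> W) : V -> W :=
  foldr (fun v h => fun x => 'D_v h x) f vs.

Definition smooth_on (R : realType) (V W : normedModType R)
    (D : set V) (f : V -> W) : Prop :=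
  forall (vs : seq V) (x : V), D x -> differentiable (iter_derive vs f) x.

(* A smooth m-manifold: Hausdorff, second countable, with an atlas of charts
   cmap c : cdom c -> R^m (inverse cinv c) whose transition maps are smooth.
   The maps are total; only their values on cdom c, resp. on its image,
   are meaningful. *)
Record manifold (R : realType) (m : nat) := Manifold {
  points :> topologicalType;
  points_hausdorff : hausdorff_space points;
  points_second_countable : @second_countable points;
  chart : Type;
  cdom : chart -> set points;
  cmap : chart -> points -> 'rV[R]_m;
  cinv : chart -> 'rV[R]_m -> points;
  cdom_open : forall c, open (cdom c);
  cdom_cover : forall p, exists c, cdom c p;
  cmap_open : forall c, open (cmap c @` cdom c);
  cmap_continuous : forall c, {within cdom c, continuous (cmap c)};
  cinv_continuous : forall c, {within cmap c @` cdom c, continuous (cinv c)};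
  cmapK : forall c p, cdom c p -> cinv c (cmap c p) = p;
  transition_smooth : forall c d,
    smooth_on (cmap c @` (cdom c `&` cdom d)) (cmap d \o cinv c)
}.
Arguments chart {R m}.
Arguments cdom {R m M} c : rename.
Arguments cmap {R m M} c p : rename.
Arguments cinv {R m M} c x : rename.

(* Jacobian at p of the change of coordinates from c to d.  Vectors are rows:
   the components of a tangent vector at p transform by u |-> u *m trans c d p *)
Definition trans (R : realType) (m : nat) (M : manifold R m)
    (c d : chart M) (p : M) : 'M[R]_m :=
  jacobian (cmap d \o cinv c) (cmap c p).

(* The index of a symmetric bilinear form G: the largest dimension of a
   subspace (row space of a row-free matrix) on which G is negative definite. *)
Definition negative_definite_on (R : realType) (m d : nat)
    (G : 'M[R]_m) (W : 'M[R]_(d, m)) : Prop :=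
  forall a : 'rV[R]_d, a != 0 -> ((a *m W) *m G *m (a *m W)^T) 0 0 < 0.

Definition has_index (R : realType) (m : nat) (G : 'M[R]_m) (t : nat) : Prop :=
  (exists W : 'M[R]_(t, m), row_free W /\ negative_definite_on G W) /\
  (forall (d : nat) (W : 'M[R]_(d, m)),
     row_free W -> negative_definite_on G W -> (d <= t)%N).

(* gmat c x is the matrix (g_ij(x)) of the metric in the chart c, as a function
   of the coordinates x. *)
Record semiRiemannian (R : realType) (m t : nat) := SemiRiemannian {
  underlying :> manifold R m;
  gmat : chart underlying -> 'rV[R]_m -> 'M[R]_m;
  gmat_smooth : forall c, forall i j : 'I_m,
    smooth_on (cmap c @` cdom c) (fun x => gmat c x i j);
  gmat_sym : forall c p, cdom c p ->
    (gmat c (cmap c p))^T = gmat c (cmap c p);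
  gmat_nondegenerate : forall c p, cdom c p -> gmat c (cmap c p) \in unitmx;
  gmat_index : forall c p, cdom c p -> has_index (gmat c (cmap c p)) t;
  gmat_trans : forall (c d : chart underlying) (p : underlying),
    cdom c p -> cdom d p ->
    gmat c (cmap c p) =
      trans c d p *m gmat d (cmap d p) *m (trans c d p)^T
}.
Arguments gmat {R m t M} c x : rename.

(* An orientation: the sign of each coordinate frame, locally constant and
   compatible with changes of charts. *)
Record orientation (R : realType) (m : nat) (M : manifold R m) := Orientation {
  osign : chart M -> M -> R;
  osign_pm1 : forall c p, cdom c p -> osign c p = 1 \/ osign c p = -1;
  osign_continuous : forall c, {within cdom c, continuous (osign c)};
  osign_trans : forall c d p, cdom c p -> cdom d p ->
    osign d p = Num.sg (\det (trans c d p)) * osign c p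
}.

(** ** Levi-Civita connection and curvature in one coordinate domain.
    G is the matrix of the metric; vector fields are functions R^m -> R^m. *)
Section Coordinates.
Variables (R : realType) (m : nat) (G : 'rV[R]_m -> 'M[R]_m).
Implicit Types (x u v w : 'rV[R]_m) (X Y Z : 'rV[R]_m -> 'rV[R]_m).

(* partial_i g_jl at x *)
Definition dg x (i j l : 'I_m) : R :=
  'D_(delta_mx 0 i) (fun y => G y j l) x.

(* Gamma^k_ij *)
Definition christoffel x (i j k : 'I_m) : R :=
  2^-1 * \sum_(l < m)
    invmx (G x) k l * (dg x i j l + dg x j i l - dg x l i j).

Definition gamma x u v : 'rV[R]_m :=
  \row_k \sum_(i < m) \sum_(j < m) christoffel x i j k * u 0 i * v 0 j.

Definition nabla X Y : 'rV[R]_m -> 'rV[R]_m :=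
  fun x => 'D_(X x) Y x + gamma x (X x) (Y x).

Definition bracket X Y : 'rV[R]_m -> 'rV[R]_m :=
  fun x => 'D_(X x) Y x - 'D_(Y x) X x.

Definition curvature X Y Z : 'rV[R]_m -> 'rV[R]_m :=
  fun x => nabla X (nabla Y Z) x - nabla Y (nabla X Z) x
           - nabla (bracket X Y) Z x.

(* The value on tangent vectors at x.  As R is a tensor, any extensions of
   u, v, w to vector fields may be used; we take those with constant
   components. *)
Definition curvature_at x u v w : 'rV[R]_m :=
  curvature (fun=> u) (fun=> v) (fun=> w) x.

End Coordinates.

Section Curves.
Variables (R : realType) (m t : nat) (M : semiRiemannian R m t).
Variables (J : set R) (g : R -> M).

Definition open_interval (I : set R) : Prop :=
  [/\ open I, is_interval I & I !=set0].

(* A vector field V along the curve g is given by its components V c s in the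
   chart c at the parameter s, relevant when J s and cdom c (g s).  Identities
   between such fields, and between the scalars built from them, are required
   in every chart around g s; for genuine (compatible) fields, holding in one
   such chart is the same as holding in all of them. *)
Definition components := chart M -> R -> 'rV[R]_m.
Implicit Types (V X Y Z : components) (c d : chart M) (s : R).

Definition smooth_curve : Prop :=
  {within J, continuous g} /\
  forall c, smooth_on [set s | J s /\ cdom c (g s)] (cmap c \o g).

Definition field_along V : Prop :=
  (forall c, smooth_on [set s | J s /\ cdom c (g s)] (V c)) /\
  (forall c d s, J s -> cdom c (g s) -> cdom d (g s) ->
     V d s = V c s *m trans c d (g s)).

Definition velocity : components := fun c s => derive1 (cmap c \o g) s.

Definition inner c s (u v : 'rV[R]_m) : R :=
  (u *m gmat c (cmap c (g s)) *m v^T) 0 0.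

Definition cov V : components := fun c s =>
  derive1 (V c) s + gamma (gmat c) (cmap c (g s)) (velocity c s) (V c s).

(* R(X,Y)Z along the curve *)
Definition Rie X Y Z : components := fun c s =>
  curvature_at (gmat c) (cmap c (g s)) (X c s) (Y c s) (Z c s).

Definition nonnull_unit_speed : Prop :=
  forall c s, J s -> cdom c (g s) ->
    `|inner c s (velocity c s) (velocity c s)| = 1.

Definition geodesic : Prop :=
  forall c s, J s -> cdom c (g s) -> cov velocity c s = 0.

Definition bitension : components := fun c s =>
  cov (cov (cov velocity)) c s + Rie (cov velocity) velocity velocity c s.

Definition biharmonic : Prop :=
  forall c s, J s -> cdom c (g s) -> bitension c s = 0.

Definition proper_biharmonic : Prop := biharmonic /\ ~ geodesic.

(* F 1, ..., F n are the frame fields, k 1, ..., k n.-1 the curvatures and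
   eps 1, ..., eps n the signs; values at other indices are irrelevant. *)
Definition frenet_frame (n : nat) (eps : nat -> R) (F : nat -> components)
    (k : nat -> R -> R) : Prop :=
  [/\ forall i, (1 <= i <= n)%N -> field_along (F i),
      forall c s, J s -> cdom c (g s) -> F 1%N c s = velocity c s,
      forall i, (1 <= i <= n)%N -> eps i = 1 \/ eps i = -1,
      forall c s, J s -> cdom c (g s) ->
        forall i j, (1 <= i <= n)%N -> (1 <= j <= n)%N ->
          inner c s (F i c s) (F j c s) = if i == j then eps i else 0
    & forall c s, J s -> cdom c (g s) ->
        [/\ cov (F 1%N) c s = (eps 2%N * k 1%N s) *: F 2%N c s,
            forall i, (1 < i < n)%N ->
              cov (F i) c s = - (eps i.-1 * k i.-1 s) *: F i.-1 c s
                              + (eps i.+1 * k i s) *: F i.+1 c s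
          & cov (F n) c s = - (eps n.-1 * k n.-1 s) *: F n.-1 c s]].

Definition positively_oriented (o : orientation M) (F : nat -> components) :
    Prop :=
  forall c s, J s -> cdom c (g s) ->
    0 < osign o c (g s) * \det (\matrix_(i < m) F i.+1 c s).

(* If M is oriented (o = Some o') and n = m, the frame is positively oriented
   and k n.-1 is not required to be positive. *)
Definition last_curvature (o : option (orientation M)) (n : nat)
    (F : nat -> components) (k : nat -> R -> R) : Prop :=
  match o with
  | Some o' =>
      if n == m then positively_oriented o' F
      else forall s, J s -> 0 < k n.-1 s
  | None => forall s, J s -> 0 < k n.-1 s
  end.

Definition frenet_curve (o : option (orientation M)) (n : nat)
    (eps : nat -> R) (F : nat -> components) (k : nat -> R -> R) : Prop :=
  [/\ smooth_curve, nonnull_unit_speed, frenet_frame n eps F k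
    & [/\ forall i, (1 <= i <= n.-1)%N -> smooth_on J (k i),
          forall i, (1 <= i < n.-1)%N -> forall s, J s -> 0 < k i s
        & last_curvature o n F k]].

End Curves.

(* Main.v *)
(* The bitension field of a Frenet curve is a combination of F_1, ..., F_4 and
   R(F_2, F_1) F_1.  Since <R(X, Y) Z, Z> = 0, its F_1-component is
   -3 eps_2 k_1 k_1', so a biharmonic curve has constant k_1; the remaining
   equations are the components along F_2, ..., F_n divided by eps_2 k_1.
   Conversely these equations kill every component along the frame, the
   curvature hypothesis kills the component orthogonal to it, and the metric is
   nondegenerate.  The skew-symmetry of R is obtained in coordinates from the
   Koszul formula and the symmetry of the second derivatives of the metric. *)
Require Import Defs.
From mathcomp Require Import ring lra.

Local Open Scope classical_set_scope.
Local Open Scope ring_scope.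

(** * Second derivatives *)

(** Since [(h + a) *: u + w = h *: u + (a *: u + w)], both sides are the limit of the same
    difference quotient. This puts a directional derivative within reach of the one-variable mean
    value theorem. *)
Lemma is_derive_line (R : realType) (V W : normedModType R) (f : V -> W)
    (u w : V) (a : R) :
  derivable f (a *: u + w) u ->
  is_derive a 1 (fun s => f (s *: u + w)) ('D_u f (a *: u + w)).
Proof.
have E : (fun h => h^-1 *: (f ((h%:A + a) *: u + w) - f (a *: u + w))) =
    (fun h => h^-1 *: (f (h *: u + (a *: u + w)) - f (a *: u + w))).
  by apply/funext => h; rewrite [h%:A]mulr1 scalerDl addrA.
by rewrite /derivable /= -E => df; split; rewrite /derive /= ?E.
Qed.

(** Only derivability along [u] is assumed, so the differential of [f] itself is not at hand. The
    restriction of [f] to the line through [x] along [u] is a function of one variable, hence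
    differentiable, and linearity of its differential gives the factor. *)
Lemma derive_scale_dir (R : realType) (V W : normedModType R) (f : V -> W)
    (k : R) (u x : V) :
  derivable f x u -> 'D_(k *: u) f x = k *: 'D_u f x.
Proof.
move=> /derivable1P/derivable1_diffP df.
have E l : 'D_(l *: u) f x = 'D_l (fun s : R => f (s *: u + x)) 0.
  have Q : (fun h => h^-1 *: (f (h *: (l *: u) + x) - f x)) =
      (fun h : R => h^-1 *: (f ((h *: l + 0) *: u + x) - f (0 *: u + x))).
    by apply/funext => h; rewrite addr0 scale0r add0r scalerA.
  by rewrite /derive /= Q.
rewrite -[in RHS](scale1r u) !E !deriveE//.
by rewrite -[k in LHS]mulr1 -linearZ.
Qed.

(** The second difference is [p h - p 0] for the function [p] below, hence [h * dp s] for some [s]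
    between [0] and [h]. Expanding ['D_u f] to first order at [x] at two points turns [dp s] into
    [h * 'D_v ('D_u f) x] plus two remainders, which explains the factor 2 in the bound. *)
Lemma near_second_difference (R : realType) (V : normedModType R)
    (f : V -> R) (u v x : V) :
  (\near x, differentiable f x) -> differentiable ('D_u f) x ->
  forall e, 0 < e -> \forall h \near 0^'+,
    `|f (h *: u + h *: v + x) - f (h *: u + x) - f (h *: v + x) + f x
      - h ^+ 2 * 'D_v ('D_u f) x| <= h ^+ 2 * (e * (2 * (`|u| + `|v|))).
Proof.
move=> df dDf e e0.
have /diff_locally/eqaddoP/(_ e e0) E := dDf.
have {}df : \forall y \near (0 : V), differentiable f (y + x).
  by move: df; rewrite (near_shift 0 x) subr0.
have {}E : \forall y \near (0 : V),
   `|'D_u f (y + x) - 'D_u f x - 'd ('D_u f) x y| <= e * `|y|.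
  by apply: filterS E => y; rewrite /= !fctE opprD addrA.
have [d /= d0 H] := (nbhs_ballP _ _).1 (filterI df E).
(* The summand 1 keeps the divisor positive when [u] and [v] both vanish. *)
have uv0 : 0 < `|u| + `|v| + 1 by rewrite ltr_wpDl// addr_ge0.
near=> h.
have h0 : 0 < h by [].
have hd : h * (`|u| + `|v| + 1) < d.
  rewrite -ltr_pdivlMr//; near: h; apply: nbhs_right_lt; exact: divr_gt0.
have small a b : 0 <= a <= h -> 0 <= b <= h ->
    `|a *: u + b *: v| <= h * (`|u| + `|v|).
  move=> /andP[a0 ah] /andP[b0 bh].
  rewrite (le_trans (ler_normD _ _))// !normrZ !ger0_norm// mulrDr.
  by rewrite lerD// ler_wpM2r.
have uvd : h * (`|u| + `|v|) < d.
  by apply: le_lt_trans hd; rewrite ler_pM2l// lerDl.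
have Hs a b : 0 <= a <= h -> 0 <= b <= h ->
  differentiable f (a *: u + b *: v + x) /\
   `|'D_u f (a *: u + b *: v + x) - 'D_u f x - 'd ('D_u f) x (a *: u + b *: v)|
     <= e * (h * (`|u| + `|v|)).
  move=> ah bh; have [|dd le] := H (a *: u + b *: v).
    rewrite -ball_normE /= sub0r normrN (le_lt_trans _ uvd)//; exact: small.
  by split => //; apply: (le_trans le); rewrite ler_pM2l// small.
pose p s := f (s *: u + (h *: v + x)) - f (s *: u + x).
pose dp s := 'D_u f (s *: u + (h *: v + x)) - 'D_u f (s *: u + x).
have h00 : 0 <= (0 : R) <= h by rewrite lexx ltW.
have hh : 0 <= h <= h by rewrite lexx andbT ltW.
have pD s : 0 <= s <= h -> is_derive s 1 p (dp s).
  move=> sh; have [d1 _] := Hs s h sh hh; have [d2 _] := Hs s 0 sh h00.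
  rewrite scale0r addr0 in d2; rewrite -addrA in d1.
  by apply: is_deriveB; apply: is_derive_line; apply: diff_derivable.
have [| |s] := @MVT R p dp 0 h h0.
- by move=> s /[!in_itv]/= /andP[s0 sh]; apply: pD; rewrite !ltW.
- apply: derivable_within_continuous => s /[!in_itv]/= sh.
  by have [] := pD s sh.
rewrite in_itv/= => /andP[s0 /ltW sh]; rewrite subr0 => ps.
have {s0}sh : 0 <= s <= h by rewrite ltW.
have [_ le1] := Hs s h sh hh; have [_ le2] := Hs s 0 sh h00.
rewrite scale0r addr0 in le2.
have -> : f (h *: u + h *: v + x) - f (h *: u + x) - f (h *: v + x) + f x =
   dp s * h.
  by rewrite -ps /p scale0r !add0r addrA; ring.
rewrite deriveE//; set L := 'd _ _ in le1 le2 *.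
have lin : L (s *: u + h *: v) - L (s *: u) = h * L v.
  by rewrite linearD addrC addKr linearZ.
(* The linear parts of the two expansions differ by exactly [h * L v], so only the two remainders
   are left. *)
rewrite (_ : _ - _ = h *
  (('D_u f (s *: u + h *: v + x) - 'D_u f x - L (s *: u + h *: v))
   - ('D_u f (s *: u + x) - 'D_u f x - L (s *: u)))); last first.
  by rewrite expr2 -mulrA -lin /dp addrA; ring.
rewrite normrM gtr0_norm// expr2 -mulrA ler_pM2l//.
rewrite (le_trans (ler_normB _ _))//.
rewrite (_ : h * _ = e * (h * (`|u| + `|v|)) + e * (h * (`|u| + `|v|)));
  last by ring.
exact: lerD.
Unshelve. all: by end_near. Qed.

Lemma norm_distl_scaled (R : realFieldType) (a b d k c : R) : 0 < k ->
  `|d - k * a| <= k * c -> `|d - k * b| <= k * c -> `|a - b| <= c + c.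
Proof.
move=> k0 le1 le2; rewrite -(ler_pM2l k0) -[X in X * _]gtr0_norm// -normrM.
rewrite (_ : k * _ = (d - k * b) - (d - k * a)); last by ring.
by rewrite (le_trans (ler_normB _ _))// mulrDr lerD.
Qed.

(* Symmetry of second derivatives from differentiability of the first ones at
   a single point: both are the limit of the same second difference quotient. *)
Lemma derive_symmetric (R : realType) (V : normedModType R)
    (f : V -> R) (u v x : V) :
  (\near x, differentiable f x) ->
  differentiable ('D_u f) x -> differentiable ('D_v f) x ->
  'D_v ('D_u f) x = 'D_u ('D_v f) x.
Proof.
move=> df du dv; apply/eqP; rewrite -subr_eq0 -normr_le0.
apply/ler_addgt0Pl => e e0; rewrite addr0.
set N := `|u| + `|v|.
(* The two estimates together cost [4 * N] times the tolerance. With tolerance [e / (4 * N + 1)] the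
   total is at most [e], even when [N = 0]. *)
have N0 : 0 < 4 * N + 1 by rewrite ltr_wpDl// mulr_ge0// addr_ge0.
have e0' : 0 < e / (4 * N + 1) by rewrite divr_gt0.
have /filterI/(_ (near_second_difference v df du e0')) :=
  near_second_difference u df dv e0'.
move=> /filterI/(_ (nbhs_right_gt 0)) /filter_ex [h [[]]].
rewrite [h *: v + h *: u]addrC [`|v| + _]addrC -/N => le1 le2 h0.
rewrite (addrAC (f _)) in le1.
apply: le_trans (norm_distl_scaled (exprn_gt0 2 h0) le2 le1) _.
rewrite (_ : _ + _ = e * (4 * N / (4 * N + 1))); last by field; rewrite gt_eqF.
by rewrite ler_piMr ?ltW// ltr_pdivrMr// mul1r ltrDl.
Qed.

(** * Derivatives of matrix-valued functions *)

Section DerivableMatrix.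
Variables (R : realType) (V : normedModType R) (x v : V).

Lemma derivable_big_sum (W : normedModType R) (I : Type) (r : seq I)
    (P : pred I) (f : I -> V -> W) :
  (forall i, P i -> derivable (f i) x v) ->
  derivable (fun y => \sum_(i <- r | P i) f i y) x v.
Proof.
move=> df; rewrite (_ : (fun _ => _) = \sum_(i <- r | P i) f i).
  elim/big_rec: _ => [|i g Pi dg]; first exact: derivable_cst.
  by apply: derivableD => //; apply: df.
by apply/funext => y; rewrite fct_sumE.
Qed.

Lemma derivable_big_prod (I : Type) (r : seq I) (P : pred I) (f : I -> V -> R) :
  (forall i, P i -> derivable (f i) x v) ->
  derivable (fun y => \prod_(i <- r | P i) f i y) x v.
Proof.
move=> df; elim: r => [|i r IH].
  by under eq_fun do rewrite big_nil; exact: derivable_cst.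
under eq_fun do rewrite big_cons.
by case: ifP => // Pi; apply: derivableM => //; apply: df.
Qed.

Lemma derivable_det (n : nat) (A : V -> 'M[R]_n) :
  (forall i j, derivable (fun y => A y i j) x v) ->
  derivable (fun y => \det (A y)) x v.
Proof.
move=> dA; apply: derivable_big_sum => s _.
by apply: derivableM; [exact: derivable_cst | apply: derivable_big_prod].
Qed.

(** Near [x] the matrix is invertible, so Cramer's rule writes each entry of the inverse as a
    cofactor divided by the determinant. *)
Lemma derivable_invmx (n : nat) (A : V -> 'M[R]_n) :
  (\near x, A x \in unitmx) ->
  (forall i j, derivable (fun y => A y i j) x v) ->
  forall i j, derivable (fun y => invmx (A y) i j) x v.
Proof.
move=> Au dA i j.
apply: (@near_eq_derivable _ _ _
    (fun y => (\det (A y))^-1 * cofactor (A y) j i)).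
  by apply: filterS Au => y Ay; rewrite /invmx Ay !mxE.
apply: derivableM.
  apply: derivableV; last exact: derivable_det.
  by rewrite -unitfE; exact: (nbhs_singleton Au).
apply: derivableM; first exact: derivable_cst.
apply: derivable_det => k l.
rewrite (_ : (fun _ => _) = fun y => A y (lift j k) (lift i l)) //.
by apply/funext => y; rewrite !mxE.
Qed.

Lemma is_derive_coord (m n : nat) (A : V -> 'M[R]_(m, n)) dA i j :
  is_derive x v A dA -> is_derive x v (fun y => A y i j) (dA i j).
Proof.
move=> [cA <-]; split; first exact: ((derivable_mxP A x v).1 cA).
by rewrite (derive_mx cA) mxE.
Qed.

Lemma is_derive_mulmx (m n p : nat) (A : V -> 'M[R]_(m, n))
    (B : V -> 'M[R]_(n, p)) dA dB :
  is_derive x v A dA -> is_derive x v B dB ->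
  is_derive x v (fun y => A y *m B y) (dA *m B x + A x *m dB).
Proof.
move=> [cA <-] [cB <-].
have eA := (derivable_mxP A x v).1 cA; have eB := (derivable_mxP B x v).1 cB.
have d i j : is_derive x v (fun y => (A y *m B y) i j)
    (\sum_k ('D_v (fun y => A y i k) x * B x k j
             + A x i k * 'D_v (fun y => B y k j) x)).
  rewrite (_ : (fun _ => _) = \sum_k (fun y => A y i k) * (fun y => B y k j)).
    apply: is_derive_sum => k.
    have := is_deriveM (derivableP (eA i k)) (derivableP (eB k j)).
    move=> /is_derive_eq; apply; rewrite addrC; congr (_ + _); exact: mulrC.
  by apply/funext => y; rewrite mxE fct_sumE.
have dAB : derivable (fun y => A y *m B y) x v.
  by apply/derivable_mxP => i j; have [] := d i j.
split => //; rewrite derive_mx//; apply/matrixP => i j; rewrite mxE.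
rewrite derive_val (derive_mx cA) (derive_mx cB) !mxE -big_split/=.
by apply: eq_bigr => k _; rewrite !mxE.
Qed.

Lemma is_derive_mulmx_const (m n p q : nat) (C : 'M[R]_(p, m))
    (A : V -> 'M[R]_(m, n)) (B : 'M[R]_(n, q)) dA :
  is_derive x v A dA -> is_derive x v (fun y => C *m A y *m B) (C *m dA *m B).
Proof.
move=> dvA.
have dCA := is_derive_mulmx (is_derive_cst C x v) dvA.
have := is_derive_mulmx dCA (is_derive_cst B x v).
by rewrite mul0mx add0r mulmx0 addr0.
Qed.

End DerivableMatrix.

(** * Levi-Civita connection and curvature in coordinates *)

Lemma trmx11 (R : Type) (A : 'M[R]_1) : A^T 0 0 = A 0 0.
Proof. by rewrite mxE. Qed.

(** The arithmetic by which two instances of the Koszul formula yield compatibility with the metric: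
    in their sum [d] and [e] cancel. *)
Lemma half_sum_eq (R : realFieldType) (p q c d e : R) :
  2 * p = c + d - e -> 2 * q = c + e - d -> c = p + q.
Proof. lra. Qed.

Section MetricForm.
Variables (R : realType) (m : nat) (G : 'rV[R]_m -> 'M[R]_m).

Definition metric_form (x a b : 'rV[R]_m) : R := (a *m G x *m b^T) 0 0.

Definition metric_derive_form (x u a b : 'rV[R]_m) : R :=
  (a *m 'D_u G x *m b^T) 0 0.

Lemma metric_formDl x a b c :
  metric_form x (a + b) c = metric_form x a c + metric_form x b c.
Proof. by rewrite /metric_form !mulmxDl mxE. Qed.

Lemma metric_formZl x k a c : metric_form x (k *: a) c = k * metric_form x a c.
Proof. by rewrite /metric_form -!scalemxAl mxE. Qed.

Lemma metric_formNl x a c : metric_form x (- a) c = - metric_form x a c.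
Proof. by rewrite -scaleN1r metric_formZl mulN1r. Qed.

Lemma metric_formBl x a b c :
  metric_form x (a - b) c = metric_form x a c - metric_form x b c.
Proof. by rewrite metric_formDl metric_formNl. Qed.

End MetricForm.

Section GammaLinear.
Variables (R : realType) (m : nat) (G : 'rV[R]_m -> 'M[R]_m) (x : 'rV[R]_m).
Implicit Types (u v w : 'rV[R]_m) (a : R).

Lemma gammaDr u v w : gamma G x u (v + w) = gamma G x u v + gamma G x u w.
Proof.
apply/rowP => k; rewrite !mxE -big_split; apply: eq_bigr => i _.
by rewrite -big_split; apply: eq_bigr => j _; rewrite mxE mulrDr.
Qed.

Lemma gammaZr u a v : gamma G x u (a *: v) = a *: gamma G x u v.
Proof.
apply/rowP => k; rewrite !mxE big_distrr; apply: eq_bigr => i _.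
by rewrite big_distrr; apply: eq_bigr => j _ /=; rewrite mxE mulrCA.
Qed.

Lemma gammaZl a u v : gamma G x (a *: u) v = a *: gamma G x u v.
Proof.
apply/rowP => k; rewrite !mxE big_distrr; apply: eq_bigr => i _.
by rewrite big_distrr; apply: eq_bigr => j _ /=; rewrite mxE; ring.
Qed.

Lemma gamma0l v : gamma G x 0 v = 0.
Proof.
apply/rowP => k; rewrite !mxE big1// => i _; rewrite big1// => j _.
by rewrite mxE mulr0 mul0r.
Qed.

(** For fields with constant components the covariant derivative reduces to [gamma] and the bracket
    vanishes. *)
Lemma curvature_atE u v w : curvature_at G x u v w =
  ('D_u (fun y => gamma G y v w) x + gamma G x u (gamma G x v w))
  - ('D_v (fun y => gamma G y u w) x + gamma G x v (gamma G x u w)).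
Proof.
have N b c : nabla G (fun=> b) (fun=> c) = fun y => gamma G y b c.
  by apply/funext => y; rewrite /nabla derive_cst add0r.
have B : bracket (fun=> u) (fun=> v) x = 0.
  by rewrite /bracket !derive_cst subrr.
by rewrite /curvature_at /curvature !N /nabla B derive0 gamma0l addr0 subr0.
Qed.

Lemma curvature_atC u v w : curvature_at G x u v w = - curvature_at G x v u w.
Proof. by rewrite !curvature_atE opprB. Qed.

End GammaLinear.

Section LeviCivita.
Variables (R : realType) (m : nat) (G : 'rV[R]_m -> 'M[R]_m) (D : set 'rV[R]_m).
Hypothesis openD : open D.
Hypothesis smoothG : forall i j, smooth_on D (fun x => G x i j).
Hypothesis symG : forall x, D x -> (G x)^T = G x.
Hypothesis unitG : forall x, D x -> G x \in unitmx.
Implicit Types (x u v w a b : 'rV[R]_m).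

Let near_D x : D x -> \near x, D x.
Proof. by move=> Dx; exact: open_nbhs_nbhs. Qed.

Let derivG x u : D x -> derivable G x u.
Proof.
move=> Dx; apply/derivable_mxP => i j.
by apply: diff_derivable; apply: (smoothG i j [::]).
Qed.

Let deriveGE x u : D x -> 'D_u G x = \matrix_(i, j) 'D_u (fun y => G y i j) x.
Proof. by move=> Dx; rewrite derive_mx//; exact: derivG. Qed.

Let derivDG x u v : D x -> derivable ('D_u G) x v.
Proof.
move=> Dx; apply: (@near_eq_derivable _ _ _
   (fun y => \matrix_(i, j) 'D_u (fun y => G y i j) y)).
  by apply: filterS (near_D Dx) => y Dy; rewrite deriveGE.
apply/derivable_mxP => i j; under eq_fun do rewrite mxE.
by apply: diff_derivable; apply: (smoothG i j [:: u]).
Qed.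

(** On the open set [D] derivatives of [G] are taken entrywise, so the symmetry for scalar functions
    applies to each entry. *)
Lemma metric_derive_symmetric x u v : D x -> 'D_v ('D_u G) x = 'D_u ('D_v G) x.
Proof.
move=> Dx; rewrite (derive_mx (@derivDG x u v Dx)).
rewrite (derive_mx (@derivDG x v u Dx)).
apply/matrixP => i j; rewrite [LHS]mxE [RHS]mxE.
have E w : \near x, 'D_w G x i j = 'D_w (fun y => G y i j) x.
  by apply: filterS (near_D Dx) => y Dy; rewrite deriveGE// mxE.
transitivity ('D_v ('D_u (fun y => G y i j)) x); first exact: near_eq_derive.
transitivity ('D_u ('D_v (fun y => G y i j)) x); last first.
  by apply: near_eq_derive; apply: filterS (E v).
apply: derive_symmetric; last 2 first.
- exact: (smoothG i j [:: u]).
- exact: (smoothG i j [:: v]).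
by apply: filterS (near_D Dx) => y Dy; apply: (smoothG i j [::]).
Qed.

Local Notation form := (metric_form G).
Local Notation dform := (metric_derive_form G).

Lemma is_derive_form (A : 'rV[R]_m -> 'rV[R]_m) x u b :
  D x -> derivable A x u ->
  is_derive x u (fun y => form y (A y) b)
    (form x ('D_u A x) b + dform x u (A x) b).
Proof.
move=> Dx dA.
have dAG := is_derive_mulmx (derivableP dA) (derivableP (@derivG x u Dx)).
have := is_derive_coord 0 0 (is_derive_mulmx dAG (is_derive_cst b^T x u)).
by rewrite mulmx0 addr0 mulmxDl mxE.
Qed.

Lemma form_sym x a b : D x -> form x a b = form x b a.
Proof.
by move=> Dx; rewrite /metric_form -[LHS]trmx11 !trmx_mul trmxK symG// mulmxA.
Qed.

Let deriveG_sum x u a b : D x -> dform x u a b =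
  \sum_(l < m) \sum_(i < m) \sum_(j < m) dg G x i j l * u 0 i * a 0 j * b 0 l.
Proof.
move=> Dx; rewrite /metric_derive_form mxE; apply: eq_bigr => l _.
rewrite !mxE exchange_big big_distrl; apply: eq_bigr => j _.
rewrite deriveGE// mxE deriveE; last exact: (smoothG j l [::]).
rewrite [in LHS](row_sum_delta u) linear_sum big_distrr big_distrl.
apply: eq_bigr => i _ /=.
rewrite linearZ /dg deriveE; last exact: (smoothG j l [::]).
by rewrite /= /GRing.scale /=; ring.
Qed.

(** In the Koszul formula for fields with constant components the brackets vanish and only
    derivatives of the metric remain. The inverse metric inside [christoffel] cancels against
    [G x]. *)
Lemma koszul x u a b : D x -> 2 * form x (gamma G x u a) b =
  dform x u a b + dform x a u b - dform x b u a.
Proof.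
(* The Christoffel symbols of the first kind, contracted with [u] and [a]. *)
move=> Dx; pose t : 'rV[R]_m := \row_l \sum_i \sum_j
  (2^-1 * (dg G x i j l + dg G x j i l - dg G x l i j) * u 0 i * a 0 j).
have -> : gamma G x u a = t *m (invmx (G x))^T.
  apply/rowP => k; rewrite !mxE.
  under [RHS]eq_bigr do rewrite !mxE big_distrl/=.
  rewrite [RHS]exchange_big; apply: eq_bigr => i _ /=.
  under [RHS]eq_bigr do rewrite big_distrl/=.
  rewrite [RHS]exchange_big; apply: eq_bigr => j _ /=.
  rewrite /christoffel big_distrr !big_distrl; apply: eq_bigr => l _ /=.
  by ring.
have -> : (invmx (G x))^T = invmx (G x) by rewrite trmx_inv symG.
rewrite /metric_form -mulmxA -[t *m _ *m _]mulmxA [invmx _ *m _]mulmxA.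
rewrite mulVmx ?unitG// mul1mx !deriveG_sum//.
(* Renaming indices gives all three sums the common factor [u 0 i * a 0 j * b 0 l], so that they can
   be compared term by term. *)
rewrite [X in _ + X - _](_ : _ = \sum_(l < m) \sum_(i < m) \sum_(j < m)
    dg G x j i l * u 0 i * a 0 j * b 0 l); last first.
  apply: eq_bigr => l _; rewrite exchange_big.
  apply: eq_bigr => i _; apply: eq_bigr => j _; ring.
rewrite [X in _ - X](_ : _ = \sum_(l < m) \sum_(i < m) \sum_(j < m)
    dg G x l i j * u 0 i * a 0 j * b 0 l); last first.
  rewrite exchange_big; apply: eq_bigr => l _; rewrite exchange_big.
  apply: eq_bigr => i _; apply: eq_bigr => j _; ring.
rewrite mxE big_distrr -big_split -sumrB; apply: eq_bigr => l _ /=.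
rewrite !mxE big_distrl big_distrr -big_split -sumrB; apply: eq_bigr => i _ /=.
rewrite big_distrl big_distrr -big_split -sumrB; apply: eq_bigr => j _ /=.
by field.
Qed.

(** Add the Koszul formulas for [(u, a, b)] and [(u, b, a)]: the derivatives along [a] and [b]
    cancel, and the derivative along [u] appears twice. *)
Lemma metric_compat x u a b : D x ->
  dform x u a b = form x (gamma G x u a) b + form x a (gamma G x u b).
Proof.
move=> Dx; rewrite (form_sym a)//.
have S c : dform x c b a = dform x c a b.
  have dsym : ('D_c G x)^T = 'D_c G x.
    rewrite deriveGE//; apply/matrixP => i j; rewrite !mxE.
    apply: near_eq_derive.
    by apply: filterS (near_D Dx) => y Dy; rewrite -[in LHS]symG// mxE.
  by rewrite /metric_derive_form -[LHS]trmx11 !trmx_mul trmxK dsym mulmxA.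
have K1 := koszul u a b Dx; have K2 := koszul u b a Dx.
rewrite (S u) in K2.
exact: half_sum_eq K1 K2.
Qed.

Let derivable_gamma x u v w : D x -> derivable (fun y => gamma G y u v) x w.
Proof.
move=> Dx; apply/derivable_mxP => i k; under eq_fun do rewrite mxE.
apply: derivable_big_sum => a _; apply: derivable_big_sum => b _.
apply: derivableM; last exact: derivable_cst.
apply: derivableM; last exact: derivable_cst.
apply: derivableM; first exact: derivable_cst.
have ddg c d e : derivable (fun y => dg G y c d e) x w.
  by apply: diff_derivable; apply: (smoothG d e [:: delta_mx 0 c]).
apply: derivable_big_sum => c _; apply: derivableM.
  apply: derivable_invmx.
    by apply: filterS (near_D Dx) => y; exact: unitG.
  by move=> d e; apply: diff_derivable; apply: (smoothG d e [::]).
by apply: derivableB; [apply: derivableD|]; exact: ddg.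
Qed.

(* Half of the commutator of [D_u] and [D_v] applied to [y |-> g_y(w, w)]. *)
Lemma curvature_skew x u v w : D x -> form x (curvature_at G x u v w) w = 0.
Proof.
move=> Dx.
pose dd a b := (w *m 'D_b ('D_a G) x *m w^T) 0 0.
(* The first derivative of g(w, w) along [a] is twice g(Gamma(a, w), w); this is differentiated once
   more, along [b]. *)
have E a b : dd a b =
   2 * (form x ('D_b (fun y => gamma G y a w) x + gamma G x b (gamma G x a w)) w
        + form x (gamma G x a w) (gamma G x b w)).
  have [_ ddE] := is_derive_coord 0 0
    (is_derive_mulmx_const w w^T (derivableP (@derivDG x a b Dx))).
  apply: etrans (esym ddE) _.
  have dgw := is_derive_form w Dx (@derivable_gamma x a w b Dx).
  have -> : form x ('D_b (fun y => gamma G y a w) x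
                    + gamma G x b (gamma G x a w)) w
        + form x (gamma G x a w) (gamma G x b w) =
      form x ('D_b (fun y => gamma G y a w) x) w + dform x b (gamma G x a w) w.
    by rewrite metric_compat// addrA metric_formDl.
  have [_ zE] := is_deriveZ 2 dgw; apply: etrans zE.
  apply: near_eq_derive; apply: filterS (near_D Dx) => y Dy.
  have H : dform y a w w = 2 * form y (gamma G y a w) w.
    by rewrite metric_compat// (form_sym w)// mulr_natl mulr2n.
  exact: H.
have : dd u v = dd v u.
  have := congr1 (fun A : 'M[R]_m => (w *m A *m w^T) 0 0)
    (@metric_derive_symmetric x u v Dx).
  exact.
have two0 : 2 != 0 :> R by rewrite pnatr_eq0.
rewrite !E => /(mulfI two0).
(* The product of the two [gamma] terms is symmetric in [u] and [v], so it cancels and only the two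
   halves of the curvature remain. *)
rewrite (form_sym (gamma G x u w))// => /addIr.
by rewrite curvature_atE metric_formBl => ->; rewrite subrr.
Qed.

(** This serves to pull the factor eps_2 k_1 of the acceleration out of the curvature term of the
    bitension field. *)
Lemma curvature_atZl x k u v w : D x ->
  curvature_at G x (k *: u) v w = k *: curvature_at G x u v w.
Proof.
move=> Dx; have gZ y a : gamma G y (k *: u) a = k *: gamma G y u a.
  exact: gammaZl.
rewrite !curvature_atE (gZ x) derive_scale_dir; last exact: derivable_gamma.
rewrite (_ : (fun y => gamma G y (k *: u) w) =
             k *: (fun y => gamma G y u w)); last first.
  exact/funext.
rewrite deriveZ; last exact: derivable_gamma.
by rewrite (gZ x) gammaZr scalerBr !scalerDr.
Qed.

End LeviCivita.

(** * Covariant derivative along a curve *)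

Lemma is_derive_scale_mx (R : realType) (V : normedModType R) (m n : nat)
    (x v : V) (f : V -> R) (A : V -> 'M[R]_(m, n)) df dA :
  is_derive x v f df -> is_derive x v A dA ->
  is_derive x v (fun y => f y *: A y) (df *: A x + f x *: dA).
Proof.
move=> fD AD.
have d i j : is_derive x v (fun y => (f y *: A y) i j)
    (df * A x i j + f x * dA i j).
  rewrite (_ : (fun _ => _) = f * (fun y => A y i j)); last first.
    by apply/funext => y; rewrite mxE.
  apply: is_derive_eq (is_deriveM fD (is_derive_coord i j AD)) _.
  by rewrite addrC; congr (_ + _); exact: mulrC.
have dfA : derivable (fun y => f y *: A y) x v.
  by apply/derivable_mxP => i j; exact: (@ex_derive _ _ _ _ _ _ _ (d i j)).
split=> //; rewrite (derive_mx dfA); apply/matrixP => i j.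
have [_ dE] := d i j; rewrite [LHS]mxE dE.
by rewrite [RHS]mxE; congr (_ + _); rewrite [RHS]mxE.
Qed.

Lemma derive1_0_constant (R : realType) (J : set R) (f : R -> R) :
  is_interval J -> (forall s, J s -> is_derive s 1 f 0) ->
  forall a b, J a -> J b -> f a = f b.
Proof.
move=> iJ df; have le a b : J a -> J b -> a <= b -> f a = f b.
  move=> Ja Jb ab.
  have Jab s : s \in `[a, b] -> J s.
    by rewrite in_itv/= => sab; exact: iJ sab.
  have [| |c _] := @MVT_segment R f (cst 0) a b ab.
  - by move=> s sab; apply/df/Jab; exact: subset_itv_oo_cc.
  - apply: derivable_within_continuous => s sab.
    by have [] := df s (Jab s sab).
  by rewrite /cst mul0r => /eqP; rewrite subr_eq0 => /eqP.
move=> a b Ja Jb; case: (leP a b) => [|/ltW] ab; first exact: le.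
by apply/esym/le.
Qed.

Section Covariant.
Variables (R : realType) (m t : nat) (M : semiRiemannian R m t).
Variables (J : set R) (g : R -> M).
Hypotheses (oJ : open J) (cg : {within J, continuous g}).
Implicit Types (V W : components M) (c : chart M) (s : R).

(** Derivatives at [s] can thus be computed in a single chart: identities known on [J] within the
    domain of [c] hold on a neighbourhood of [s]. *)
Lemma near_chart c s : J s -> cdom c (g s) -> \near s, J s /\ cdom c (g s).
Proof.
move=> Js cs; apply: filterI; first exact: open_nbhs_nbhs.
move: cg; rewrite continuous_open_subspace// => /(_ s (mem_set Js)); apply.
by apply: open_nbhs_nbhs; split=> //; exact: cdom_open.
Qed.

Lemma smooth_on_derivable (W : normedModType R) (D : set R) (f : R -> W) s :
  smooth_on D f -> D s -> derivable f s 1.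
Proof. by move=> sf Ds; apply: diff_derivable; exact: (sf [::]). Qed.

(** Covariant differentiation is local. This allows iterated derivatives to be rewritten by formulas
    that are valid only where the curve lies in the chart. *)
Lemma near_eq_cov V W c s : (\near s, V c s = W c s) ->
  cov g V c s = cov g W c s.
Proof.
move=> VW; have VWs : V c s = W c s := nbhs_singleton VW.
rewrite /cov VWs; apply: (congr1 (fun z => z + _)).
apply: etrans (derive1E _ _) _; apply: etrans (near_eq_derive _ VW) _.
exact/esym/derive1E.
Qed.

Lemma covD V W c s : derivable (V c) s 1 -> derivable (W c) s 1 ->
  cov g (fun c s => V c s + W c s) c s = cov g V c s + cov g W c s.
Proof.
move=> dV dW; rewrite /cov gammaDr addrACA; congr (_ + _).
apply: etrans (derive1E _ _) _; apply: etrans (deriveD dV dW) _.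
by rewrite (derive1E (V c)) (derive1E (W c)).
Qed.

Lemma covZ (k : R -> R) dk V c s : is_derive s 1 k dk -> derivable (V c) s 1 ->
  cov g (fun c s => k s *: V c s) c s = dk *: V c s + k s *: cov g V c s.
Proof.
move=> dkE dV; rewrite /cov gammaZr scalerDr addrA; congr (_ + _).
have [_ dE] := is_derive_scale_mx dkE (derivableP dV).
apply: etrans (derive1E _ _) _; apply: etrans dE _.
by rewrite (derive1E (V c)).
Qed.

Lemma innerE c s u v :
  inner g c s u v = metric_form (gmat c) (cmap c (g s)) u v.
Proof. by []. Qed.

Lemma innerC c s u v : cdom c (g s) -> inner g c s u v = inner g c s v u.
Proof.
move=> cs; apply: (@form_sym _ _ _ (cmap c @` cdom c)) => [_ [p cp <-]|].
  exact: gmat_sym.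
by exists (g s).
Qed.

(** Testing against the coordinate basis shows that [u] times the metric matrix is zero, and that
    matrix is invertible. *)
Lemma inner_nondegenerate c s u : cdom c (g s) ->
  (forall w, inner g c s u w = 0) -> u = 0.
Proof.
move=> cs u0; have G := gmat_nondegenerate cs.
rewrite -[u](mulmxK G) (_ : u *m _ = 0) ?mul0mx//.
apply/rowP => i; have := u0 (delta_mx 0 i).
by rewrite /inner trmx_delta -colE !mxE.
Qed.

Lemma Rie_skew c s (X Y Z : components M) : cdom c (g s) ->
  inner g c s (Rie g X Y Z c s) (Z c s) = 0.
Proof.
move=> cs; apply: (@curvature_skew _ _ _ (cmap c @` cdom c)).
- exact: cmap_open.
- exact: gmat_smooth.
- by move=> _ [p cp <-]; exact: gmat_sym.
- by move=> _ [p cp <-]; exact: gmat_nondegenerate.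
- by exists (g s).
Qed.

Lemma RieC c s (X Y Z : components M) : Rie g X Y Z c s = - Rie g Y X Z c s.
Proof. exact: curvature_atC. Qed.

(** [Rie] depends only on the values of its arguments at [s], so a relation at that one parameter
    suffices. *)
Lemma Rie_scaled c s (X Y Z X' : components M) k : cdom c (g s) ->
  X c s = k *: X' c s -> Rie g X Y Z c s = k *: Rie g X' Y Z c s.
Proof.
move=> cs XE; rewrite /Rie XE.
apply: (@curvature_atZl _ _ _ (cmap c @` cdom c)).
- exact: cmap_open.
- exact: gmat_smooth.
- by move=> _ [p cp <-]; exact: gmat_nondegenerate.
- by exists (g s).
Qed.

End Covariant.

(** * Frenet curves *)

Section Frenet.
Variables (R : realType) (m t n : nat) (M : semiRiemannian R m t).
Variables (o : option (orientation M)) (J : set R) (g : R -> M).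
Variables (eps : nat -> R) (F : nat -> components M) (k : nat -> R -> R).
Hypotheses (n4 : (4 <= n)%N) (oJ : open J).
Hypothesis frenet : frenet_curve J g o n eps F k.
Implicit Types (c : chart M) (s : R).

Let curve_continuous : {within J, continuous g}.
Proof. by have [[]] := frenet. Qed.

Let near_domain c s : J s -> cdom c (g s) -> \near s, J s /\ cdom c (g s).
Proof. by move=> Js cs; exact: near_chart. Qed.

Let frame_derivable i c s : (1 <= i <= n)%N -> J s -> cdom c (g s) ->
  derivable (F i c) s 1.
Proof.
move=> ni Js cs; have [_ _ [FA _ _ _ _] _] := frenet.
exact: smooth_on_derivable ((FA i ni).1 c) _.
Qed.

(** As [4 <= n], the indices 1, 2, 3 do not exceed [n.-1]. *)
Let curvature_smooth i : (1 <= i <= 3)%N -> smooth_on J (k i).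
Proof.
move=> /andP[i1 i3]; have [_ _ _ [kS _ _]] := frenet; apply: kS.
by rewrite i1 (leq_trans i3)// -ltnS prednK// (leq_trans _ n4).
Qed.

Let curvature_derivable i s : (1 <= i <= 3)%N -> J s -> derivable (k i) s 1.
Proof. by move=> /curvature_smooth kS; exact: smooth_on_derivable. Qed.

Lemma frenet_curvature_is_derive i s : (1 <= i <= 3)%N -> J s ->
  is_derive s 1 (k i) (derive1 (k i) s).
Proof.
by move=> i3 Js; rewrite derive1E; exact/derivableP/curvature_derivable.
Qed.

Let curvature_derivable2 i s : (1 <= i <= 3)%N -> J s ->
  derivable (derive1 (k i)) s 1.
Proof.
move=> /curvature_smooth kS Js; have -> : derive1 (k i) = 'D_1 (k i).
  by apply/funext => x; rewrite derive1E.
by apply: diff_derivable; exact: (kS [:: 1]).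
Qed.

Lemma eps_sqr i : (1 <= i <= n)%N -> eps i * eps i = 1.
Proof.
move=> ni; have [_ _ [_ _ E _ _] _] := frenet.
by have [->|->] := E i ni; rewrite ?mulrNN mul1r.
Qed.

Lemma cov_F1 c s : J s -> cdom c (g s) ->
  cov g (F 1%N) c s = (eps 2%N * k 1%N s) *: F 2%N c s.
Proof.
by move=> Js cs; have [_ _ [_ _ _ _ E] _] := frenet; have [] := E c s Js cs.
Qed.

Lemma cov_F i c s : (1 < i < n)%N -> J s -> cdom c (g s) ->
  cov g (F i) c s = - (eps i.-1 * k i.-1 s) *: F i.-1 c s
                    + (eps i.+1 * k i s) *: F i.+1 c s.
Proof.
move=> ni Js cs; have [_ _ [_ _ _ _ E] _] := frenet.
by have [_ H _] := E c s Js cs; exact: H.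
Qed.

Lemma velocity_F1 c s : J s -> cdom c (g s) -> velocity g c s = F 1%N c s.
Proof. by move=> Js cs; have [_ _ [_ E _ _ _] _] := frenet; rewrite E. Qed.

Lemma cov_velocity c s : J s -> cdom c (g s) ->
  cov g (velocity g) c s = (eps 2%N * k 1%N s) *: F 2%N c s.
Proof.
move=> Js cs; rewrite -cov_F1//; apply: near_eq_cov.
by apply: filterS (near_domain Js cs) => r [Jr cr]; rewrite velocity_F1.
Qed.

Lemma cov_cov_velocity c s : J s -> cdom c (g s) ->
  cov g (cov g (velocity g)) c s =
  (- (eps 1%N * eps 2%N) * k 1%N s ^+ 2) *: F 1%N c s
  + (eps 2%N * derive1 (k 1%N) s) *: F 2%N c s
  + (eps 2%N * eps 3%N * (k 1%N s * k 2%N s)) *: F 3%N c s.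
Proof.
move=> Js cs.
have n2 : (1 <= 2 <= n)%N by rewrite (leq_trans _ n4).
have n2' : (1 < 2 < n)%N by rewrite (leq_trans _ n4).
transitivity (cov g (fun c s => (eps 2%N * k 1%N s) *: F 2%N c s) c s).
  apply: near_eq_cov; apply: filterS (near_domain Js cs) => r [Jr cr].
  by rewrite cov_velocity.
have k1D := frenet_curvature_is_derive (isT : (1 <= 1 <= 3)%N) Js.
rewrite (covZ _ (is_deriveZ (eps 2%N) k1D)); last exact: frame_derivable.
by rewrite cov_F//=; apply/rowP => j; rewrite !mxE /GRing.scale /=; ring.
Qed.

Lemma cov3_velocity c s : J s -> cdom c (g s) ->
  cov g (cov g (cov g (velocity g))) c s =
  (- 3 * (eps 1%N * eps 2%N) * (k 1%N s * derive1 (k 1%N) s)) *: F 1%N c s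
  + (eps 2%N * derive1 (derive1 (k 1%N)) s - eps 1%N * k 1%N s ^+ 3
     - eps 3%N * (k 1%N s * k 2%N s ^+ 2)) *: F 2%N c s
  + (eps 2%N * eps 3%N * (2 * derive1 (k 1%N) s * k 2%N s
     + k 1%N s * derive1 (k 2%N) s)) *: F 3%N c s
  + (eps 2%N * eps 3%N * eps 4%N * (k 1%N s * k 2%N s * k 3%N s)) *: F 4%N c s.
Proof.
move=> Js cs.
have n1 : (1 <= 1 <= n)%N by rewrite (leq_trans _ n4).
have n2 : (1 <= 2 <= n)%N by rewrite (leq_trans _ n4).
have n3 : (1 <= 3 <= n)%N by rewrite (leq_trans _ n4).
have n2' : (1 < 2 < n)%N by rewrite (leq_trans _ n4).
(* Because [4 <= n], the derivative of F_3 obeys an intermediate Frenet equation and brings in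
   F_4. *)
have n3' : (1 < 3 < n)%N by [].
pose a1 r := - (eps 1%N * eps 2%N) * k 1%N r ^+ 2.
pose a2 r := eps 2%N * derive1 (k 1%N) r.
pose a3 r := eps 2%N * eps 3%N * (k 1%N r * k 2%N r).
transitivity (cov g (fun c r =>
    a1 r *: F 1%N c r + a2 r *: F 2%N c r + a3 r *: F 3%N c r) c s).
  apply: near_eq_cov; apply: filterS (near_domain Js cs) => r [Jr cr].
  by rewrite cov_cov_velocity.
have k1D := frenet_curvature_is_derive (isT : (1 <= 1 <= 3)%N) Js.
have k2D := frenet_curvature_is_derive (isT : (1 <= 2 <= 3)%N) Js.
have k11D := derivableP (curvature_derivable2 (isT : (1 <= 1 <= 3)%N) Js).
have a1D : is_derive s 1 a1
    (- (eps 1%N * eps 2%N) * (2 * (k 1%N s * derive1 (k 1%N) s))).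
  apply: is_derive_eq (is_deriveZ _ (is_deriveM k1D k1D)) _.
  by rewrite /GRing.scale /=; ring.
have a2D : is_derive s 1 a2 (eps 2%N * derive1 (derive1 (k 1%N)) s).
  by rewrite (derive1E (derive1 (k 1%N))); exact: is_deriveZ k11D.
have a3D : is_derive s 1 a3
    (eps 2%N * eps 3%N
      * (k 1%N s * derive1 (k 2%N) s + k 2%N s * derive1 (k 1%N) s)).
  exact: is_deriveZ (is_deriveM k1D k2D).
have F1D := frame_derivable n1 Js cs.
have F2D := frame_derivable n2 Js cs.
have F3D := frame_derivable n3 Js cs.
have [b1D _] := is_derive_scale_mx a1D (derivableP F1D).
have [b2D _] := is_derive_scale_mx a2D (derivableP F2D).
have [b3D _] := is_derive_scale_mx a3D (derivableP F3D).
have b12D := derivableD b1D b2D.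
apply: etrans (covD (V := fun c r => a1 r *: F 1%N c r + a2 r *: F 2%N c r)
  (W := fun c r => a3 r *: F 3%N c r) _ b12D b3D) _.
rewrite (covD (V := fun c r => a1 r *: F 1%N c r)
  (W := fun c r => a2 r *: F 2%N c r) _ b1D b2D).
rewrite (covZ _ a1D F1D) (covZ _ a2D F2D) (covZ _ a3D F3D) cov_F1// !cov_F//=.
(* Both cubic terms in the coefficient of F_2 carry the square of eps_2, which is 1. *)
have e2 := eps_sqr n2.
apply/rowP => j; rewrite /a1 /a2 /a3 !mxE.
ring: e2.
Qed.

Lemma bitensionE c s : J s -> cdom c (g s) ->
  bitension g c s =
  (- 3 * (eps 1%N * eps 2%N) * (k 1%N s * derive1 (k 1%N) s)) *: F 1%N c s
  + (eps 2%N * derive1 (derive1 (k 1%N)) s - eps 1%N * k 1%N s ^+ 3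
     - eps 3%N * (k 1%N s * k 2%N s ^+ 2)) *: F 2%N c s
  + (eps 2%N * eps 3%N * (2 * derive1 (k 1%N) s * k 2%N s
     + k 1%N s * derive1 (k 2%N) s)) *: F 3%N c s
  + (eps 2%N * eps 3%N * eps 4%N * (k 1%N s * k 2%N s * k 3%N s)) *: F 4%N c s
  + (eps 2%N * k 1%N s) *: Rie g (F 2%N) (F 1%N) (F 1%N) c s.
Proof.
move=> Js cs; rewrite /bitension cov3_velocity//; congr (_ + _).
rewrite -(Rie_scaled _ _ cs (cov_velocity Js cs)).
by rewrite /Rie !velocity_F1.
Qed.

(** * Components of the bitension field along the frame *)

Let low_range : [/\ (1 <= 1 <= n)%N, (1 <= 2 <= n)%N, (1 <= 3 <= n)%N
  & (1 <= 4 <= n)%N].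
Proof. by rewrite !(leq_trans _ n4). Qed.

Lemma innerF c s i j : (1 <= i <= n)%N -> (1 <= j <= n)%N ->
  J s -> cdom c (g s) ->
  inner g c s (F i c s) (F j c s) = if i == j then eps i else 0.
Proof. by move=> ni nj Js cs; have [_ _ [_ _ _ E _] _] := frenet; exact: E. Qed.

(** As [4 <= n], the index 1 lies below [n.-1], so k_1 is never the last curvature, whose sign may
    be free. *)
Lemma k1_gt0 s : J s -> 0 < k 1%N s.
Proof.
move=> Js; have [_ _ _ [_ kP _]] := frenet; apply: kP => //.
by case: n n4 => [|[|[|]]].
Qed.

Lemma inner_bitension c s w : J s -> cdom c (g s) ->
  inner g c s (bitension g c s) w =
  (- 3 * (eps 1%N * eps 2%N) * (k 1%N s * derive1 (k 1%N) s))
    * inner g c s (F 1%N c s) w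
  + (eps 2%N * derive1 (derive1 (k 1%N)) s - eps 1%N * k 1%N s ^+ 3
     - eps 3%N * (k 1%N s * k 2%N s ^+ 2)) * inner g c s (F 2%N c s) w
  + (eps 2%N * eps 3%N * (2 * derive1 (k 1%N) s * k 2%N s
     + k 1%N s * derive1 (k 2%N) s)) * inner g c s (F 3%N c s) w
  + (eps 2%N * eps 3%N * eps 4%N * (k 1%N s * k 2%N s * k 3%N s))
    * inner g c s (F 4%N c s) w
  + (eps 2%N * k 1%N s) * inner g c s (Rie g (F 2%N) (F 1%N) (F 1%N) c s) w.
Proof.
move=> Js cs; rewrite bitensionE//; move: (Rie g _ _ _ c s) => r.
by rewrite !innerE !metric_formDl !metric_formZl.
Qed.

(** The frame is orthonormal up to signs, so every vector splits into a combination of the frame and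
    a vector orthogonal to it. The hypotheses make [u] orthogonal to both parts. *)
Lemma frame_nondegenerate c s u : J s -> cdom c (g s) ->
  (forall i, (1 <= i <= n)%N -> inner g c s u (F i c s) = 0) ->
  (forall w, (forall i, (1 <= i <= n)%N -> inner g c s (F i c s) w = 0) ->
     inner g c s u w = 0) ->
  u = 0.
Proof.
move=> Js cs uF uW; apply: (inner_nondegenerate cs) => w; rewrite innerC//.
(* The orthogonal projection of [w] onto the span of the frame; [eps i] is its own inverse and
   stands for division by the square of F_i. *)
pose p := \sum_(1 <= i < n.+1) (eps i * inner g c s (F i c s) w) *: F i c s.
have pE v : inner g c s p v = \sum_(1 <= i < n.+1)
    eps i * inner g c s (F i c s) w * inner g c s (F i c s) v.
  rewrite /inner !mulmx_suml summxE; apply: eq_bigr => i _.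
  by rewrite -!scalemxAl mxE.
have nat_range i : (i \in index_iota 1 n.+1) = (1 <= i <= n)%N.
  by rewrite mem_index_iota ltnS.
have := uW (w - p); rewrite innerC// innerE metric_formBl -!innerE pE.
rewrite big1_seq ?subr0; last first.
  move=> i; rewrite nat_range => /= ni.
  by rewrite [X in _ * X]innerC// uF// mulr0.
apply=> i ni; rewrite innerC// innerE metric_formBl -!innerE pE.
rewrite (bigD1_seq i) ?nat_range ?iota_uniq//= big1_seq; last first.
  move=> j; rewrite nat_range => /andP[/negPf ji nj].
  by rewrite innerF// ji mulr0.
rewrite innerF// eqxx addr0 mulrAC eps_sqr// mul1r.
by rewrite [X in X - _]innerC// subrr.
Qed.

Let derive1_k1_locally0 s : (forall r, J r -> derive1 (k 1%N) r = 0) -> J s ->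
  derive1 (derive1 (k 1%N)) s = 0.
Proof.
move=> k0 Js; rewrite derive1E.
apply: etrans (derive_cst (0 : R) s (1 : R)); apply: near_eq_derive.
by apply: filterS (open_nbhs_nbhs (conj oJ Js)) => r Jr; rewrite k0.
Qed.

(** The curvature term drops out by skew-symmetry, and the square of F_1 absorbs the factor
    eps_1. *)
Lemma inner_bitension_tangent c s : J s -> cdom c (g s) ->
  inner g c s (bitension g c s) (F 1%N c s)
  = - 3 * eps 2%N * (k 1%N s * derive1 (k 1%N) s).
Proof.
move=> Js cs; have [n1 n2 n3 n4'] := low_range.
rewrite inner_bitension// !innerF//= Rie_skew//.
have e1 := eps_sqr n1; ring: e1.
Qed.

(** Once k_1' and k_1'' vanish, every remaining term contains eps_2 k_1, after eps_3 and eps_4 have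
    been squared away. Beyond F_4 only the curvature term contributes. *)
Lemma inner_bitension_normal c s : (forall r, J r -> derive1 (k 1%N) r = 0) ->
  J s -> cdom c (g s) ->
  let B i := inner g c s (bitension g c s) (F i c s) in
  let Q i := inner g c s (Rie g (F 2%N) (F 1%N) (F 1%N) c s) (F i c s) in
  [/\ B 2%N = eps 2%N * k 1%N s *
        (Q 2%N - (eps 1%N * k 1%N s ^+ 2 + eps 3%N * k 2%N s ^+ 2)),
      B 3%N = eps 2%N * k 1%N s * (derive1 (k 2%N) s + Q 3%N),
      B 4%N = eps 2%N * k 1%N s * (eps 3%N * k 2%N s * k 3%N s + Q 4%N)
    & forall i, (5 <= i <= n)%N -> B i = eps 2%N * k 1%N s * Q i].
Proof.
move=> k0 Js cs B Q; have [n1 n2 n3 n4'] := low_range.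
have e3 := eps_sqr n3; have e4 := eps_sqr n4'.
have k00 := derive1_k1_locally0 k0 Js.
rewrite /B; split=> [|||i /andP[i5 ni]].
1-3: rewrite inner_bitension// !innerF//= -/(Q _) k0// k00.
- by ring.
- by ring: e3.
- by ring: e4.
have ni1 : (1 <= i <= n)%N by rewrite ni (leq_trans _ i5).
rewrite inner_bitension// !innerF// !ltn_eqF ?(leq_trans _ i5)//.
by rewrite !mulr0 !add0r.
Qed.

End Frenet.

(** * Characterization of proper biharmonic Frenet curves *)

Theorem theorem1p18 (R : realType) (m t n : nat) (M : semiRiemannian R m t)
    (o : option (orientation M)) (J : set R) (g : R -> M)
    (eps : nat -> R) (F : nat -> components M) (k : nat -> R -> R) :
  (1 <= t <= m - 1)%N -> (4 <= n <= m)%N ->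
  open_interval J ->
  frenet_curve J g o n eps F k ->
  (forall c s, J s -> cdom c (g s) ->
     forall w : 'rV[R]_m,
       (forall i, (1 <= i <= n)%N -> inner g c s (F i c s) w = 0) ->
       inner g c s (Rie g (F 1%N) (F 2%N) (F 1%N) c s) w = 0) ->
  proper_biharmonic J g <->
  (exists kappa1 : R, 0 < kappa1 /\ forall s, J s -> k 1%N s = kappa1) /\
  (forall c s, J s -> cdom c (g s) ->
     let Q i := inner g c s (Rie g (F 2%N) (F 1%N) (F 1%N) c s) (F i c s) in
     [/\ eps 1%N * k 1%N s ^+ 2 + eps 3%N * k 2%N s ^+ 2 = Q 2%N,
         derive1 (k 2%N) s = - Q 3%N,
         eps 3%N * k 2%N s * k 3%N s = - Q 4%N
       & forall i, (5 <= i <= n)%N -> Q i = 0]).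
Proof.
move=> _ /andP[n4 _] [oJ iJ [s0 Js0]] frenet RW.
have n2 : (1 <= 2 <= n)%N by rewrite (leq_trans _ n4).
have e2 := eps_sqr frenet n2.
have kpos := k1_gt0 n4 frenet.
(* This factor is cancelled in every normal component, and its nonvanishing also excludes
   geodesics. *)
have ek s : J s -> eps 2%N * k 1%N s != 0.
  move=> /kpos k0; rewrite mulf_neq0//; last by rewrite gt_eqF.
  by apply/eqP => e0; move: e2 => /eqP; rewrite e0 mul0r eq_sym oner_eq0.
have kS s : J s -> is_derive s 1 (k 1%N) (derive1 (k 1%N) s).
  exact: (frenet_curvature_is_derive n4 frenet (isT : (1 <= 1 <= 3)%N)).
split.
- case=> bih _.
  have B0 c s w : J s -> cdom c (g s) -> inner g c s (bitension g c s) w = 0.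
    by move=> Js cs; rewrite bih// /inner !mul0mx mxE.
  have k0 s : J s -> derive1 (k 1%N) s = 0.
    move=> Js; have [c cs] := cdom_cover (g s).
    have /eqP := B0 c s (F 1%N c s) Js cs.
    rewrite (inner_bitension_tangent n4 oJ frenet)//.
    (* The product is regrouped as [-3 * (eps 2%N * k 1%N s)] times k_1', whose first two factors
       are nonzero. *)
    rewrite mulrA -(mulrA (- 3)) mulf_eq0 mulf_eq0 (negPf (ek s Js)).
    by rewrite oppr_eq0 pnatr_eq0 => /eqP.
  split; first exists (k 1%N s0).
    split=> [|s Js]; first exact: kpos.
    by apply: (derive1_0_constant iJ) => // r Jr; rewrite -(k0 r Jr); exact: kS.
  move=> c s Js cs.
  have [B2 B3 B4 Bi] := inner_bitension_normal n4 oJ frenet k0 Js cs.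
  have cancel (x : R) : 0 = eps 2%N * k 1%N s * x -> x = 0.
    by move/esym/eqP; rewrite mulf_eq0 (negPf (ek s Js)) => /eqP.
  rewrite !B0// in B2 B3 B4; split.
  + by apply/esym/eqP; rewrite -subr_eq0; apply/eqP/cancel.
  + by apply/eqP; rewrite -addr_eq0; apply/eqP/cancel.
  + by apply/eqP; rewrite -addr_eq0; apply/eqP/cancel.
  + by move=> i ni; apply: cancel; rewrite -Bi// B0.
- case=> [[kappa1 [_ kc]] eqs].
  have k0 s : J s -> derive1 (k 1%N) s = 0.
    move=> Js; rewrite derive1E; apply: etrans (derive_cst kappa1 s (1 : R)).
    apply: near_eq_derive.
    by apply: filterS (open_nbhs_nbhs (conj oJ Js)) => r Jr; rewrite kc.
  split.
    move=> c s Js cs; apply: (frame_nondegenerate frenet Js cs).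
      have [B2 B3 B4 Bi] := inner_bitension_normal n4 oJ frenet k0 Js cs.
      have [E2 E3 E4 Ei] := eqs c s Js cs.
      case=> [|[|[|[|[|i]]]]]// ni.
      + by rewrite (inner_bitension_tangent n4 oJ frenet)// k0// !mulr0.
      + by rewrite B2 E2 subrr mulr0.
      + by rewrite B3 E3 addNr mulr0.
      + by rewrite B4 E4 addNr mulr0.
      + by rewrite Bi// Ei// mulr0.
    (* For [w] orthogonal to the frame only the curvature term is left. Exchanging its first two
       arguments brings it to the form of the curvature hypothesis. *)
    move=> w wF; rewrite (inner_bitension n4 oJ frenet)//.
    rewrite !wF ?(leq_trans _ n4)// RieC innerE metric_formNl -innerE RW//.
    by rewrite oppr0 !mulr0 !addr0.
  (* On a geodesic the acceleration eps_2 k_1 F_2 would vanish at [s0], forcing F_2 = 0 there,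
     although its square is eps_2, which is nonzero. *)
  have [c cs] := cdom_cover (g s0) => geo.
  have := innerF frenet n2 n2 Js0 cs; have := geo c s0 Js0 cs.
  rewrite (cov_velocity oJ frenet)// => /eqP; rewrite scaler_eq0.
  rewrite (negPf (ek s0 Js0)) /= => /eqP ->; rewrite /inner !mul0mx mxE => e0.
  by move: e2 => /eqP; rewrite -e0 mul0r eq_sym oner_eq0.
Qed.
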